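(* Let $2\le k\le n$, let $\beta_0,\dots,\beta_{k-2}\ge0$ be real numbers (the values at a point of nonnegative functions), and for $\lambda\in\Gamma_{k-1}\subset\mathbb R^n$ set $$f(\lambda)=\frac{\sigma_k(\lambda)}{\sigma_{k-1}(\lambda)}-\sum_{l=0}^{k-2}\beta_l\frac{\sigma_l(\lambda)}{\sigma_{k-1}(\lambda)},\qquad f_i=\frac{\partial f}{\partial\lambda_i}.$$ Then for every $\lambda\in\Gamma_{k-1}$, $$\sum_{i=1}^n f_i(\lambda)\ge\frac{n-k+1}{k}.$$
   Context: For $\lambda\in\mathbb R^n$, $\sigma_j(\lambda)$ is the $j$-th elementary symmetric function, with $\sigma_0=1$, and $\Gamma_j=\{\lambda\in\mathbb R^n:\sigma_i(\lambda)>0,\ 1\le i\le j\}$. *)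

(* Defs.v *)
From HB Require Import structures.
From mathcomp Require Import all_boot all_order all_algebra.
From mathcomp Require Import all_classical all_reals all_analysis.
(* Only the algebraic structures of mpoly are imported: its notations clash with
   those of the analysis library. *)
From mathcomp Require mpoly.
Import (canonicals, coercions) mpoly.

Set Implicit Arguments.
Unset Strict Implicit.
Unset Printing Implicit Defensive.

Import Order.TTheory GRing.Theory Num.Theory.
Import numFieldNormedType.Exports.

Local Open Scope classical_set_scope.
Local Open Scope ring_scope.

Definition sigma (R : realType) (n j : nat) (lambda : 'rV[R]_n) : R :=
  mpoly.meval (fun i => lambda 0 i) (mpoly.mesym n R j).

Lemma sigmaE (R : realType) (n j : nat) (lambda : 'rV[R]_n) :
  sigma j lambda = \sum_(A : {set 'I_n} | #|A| == j) \prod_(i in A) lambda 0 i.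
Proof.
rewrite /sigma /mpoly.mesym raddf_sum /=; apply: eq_bigr => A _.
by rewrite rmorph_prod /=; apply: eq_bigr => i _; rewrite mpoly.mevalXU.
Qed.

Definition Gamma (R : realType) (n j : nat) : set 'rV[R]_n :=
  [set lambda | forall i, (1 <= i <= j)%N -> 0 < sigma i lambda].

(* Indices l = 0, ..., k - 2 are the elements of 'I_k.-1. *)
Definition sigma_quot (R : realType) (n k : nat) (beta : 'I_k.-1 -> R)
    (lambda : 'rV[R]_n) : R :=
  sigma k lambda / sigma k.-1 lambda
  - \sum_(l < k.-1) beta l * (sigma l lambda / sigma k.-1 lambda).

(* Partial derivative in the i-th coordinate: the directional derivative along
   the i-th vector of the standard basis. *)
Definition partial (R : realType) (n : nat) (g : 'rV[R]_n -> R) (i : 'I_n)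
    (lambda : 'rV[R]_n) : R :=
  'D_(delta_mx 0 i) g lambda.

(* Main.v *)
(* By the Euler-type identity sum_i d_i sigma_j = (n - j + 1) sigma_(j-1), the sum
   of the f_i is an explicit rational function of the sigma_j.  Newton's inequality
   sigma_(k-2) sigma_k <= c sigma_(k-1)^2, with its sharp constant c, bounds the
   contribution of sigma_k / sigma_(k-1) from below.  The beta_l contribution is
   nonnegative because, again by Newton, sigma_j / ((n - j + 1) sigma_(j-1))
   decreases in j as long as the sigma_j are positive.

   Newton's inequality holds for all real lambda.  Differentiation preserves
   real-rootedness (Gauss-Lucas) and merely rescales the coefficients of
   prod_i (X - lambda_i), which reduces it to the three lowest coefficients;
   there it follows by adding the roots one at a time. *)
Require Import Defs.
From HB Require Import structures.
From mathcomp Require Import all_boot all_order all_algebra.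
From mathcomp Require Import all_classical all_reals all_analysis.
From mathcomp Require Import ring lra polyorder.
From mathcomp Require mpoly complex.
Import (canonicals, coercions) mpoly.
Import (canonicals, coercions, notations) complex.

Set Implicit Arguments.
Unset Strict Implicit.
Unset Printing Implicit Defensive.

Import Order.TTheory GRing.Theory Num.Theory.
Import numFieldNormedType.Exports.

Local Open Scope classical_set_scope.
Local Open Scope ring_scope.

(** * Real-rootedness of the derivative *)

(** Off the real axis, each summand 1/(z - a) of p'/p has imaginary part of sign opposite to [Im z],
    so p' cannot vanish there. *)
Lemma deriv_prod_XsubC_root_real (R : rcfType) (s : seq R) (z : complex.complex R) :
  s != [::] -> root (\prod_(a <- s) ('X - (a%:C%C)%:P))^`() z ->
  complex.Im z = 0.
Proof.
move=> s_nil pz0; apply/eqP/negP => /negP y0; move: s_nil pz0.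
set y := complex.Im z in y0 *.
pose p (t : seq R) := \prod_(a <- t) ('X - (a%:C%C)%:P) : {poly complex.complex R}.
pose nsq (x : complex.complex R) := complex.Re x ^+ 2 + complex.Im x ^+ 2.
(* [w t] is the imaginary part of p'(z) conj(p(z)), so [y * w t] has the sign of
   y Im (p'/p)(z), which is negative as soon as p has a root. *)
pose w t := complex.Im (p t)^`().[z] * complex.Re (p t).[z]
            - complex.Re (p t)^`().[z] * complex.Im (p t).[z].
have pz t : 0 < nsq (p t).[z].
  have: (p t).[z] != 0.
    rewrite /p horner_prod prodf_seq_neq0; apply/allP => a _ /=.
    rewrite hornerXsubC subr_eq0; apply: contraNneq y0 => za.
    by rewrite /y za.
  by rewrite -normr_gt0; case: (p t).[z] => u v; rewrite complex.ltcR sqrtr_gt0.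
(* With q the product over [t], p' conj(p) = |q|^2 conj(z - a) + |z - a|^2 q' conj(q) at z. *)
have wS a t : y * w (a :: t) =
    - (y ^+ 2 * nsq (p t).[z]) + nsq (z - a%:C%C) * (y * w t).
  rewrite /w /p !big_cons derivM derivXsubC mul1r hornerD !hornerM hornerXsubC.
  rewrite /y /nsq; move: (\prod_(_ <- t) _).[z] (\prod_(_ <- t) _)^`().[z].
  by case: (z) => x1 x2 [q1 q2] [d1 d2] /=; ring.
have w_le0 t : y * w t <= 0.
  elim: t => [|a t IH].
    by rewrite /w /p big_nil derivC horner0 /= !mul0r subrr mulr0.
  rewrite wS -oppr_ge0 opprD addr_ge0 ?opprK ?oppr_ge0 //.
    by rewrite mulr_ge0 ?sqr_ge0 ?ltW.
  by rewrite mulr_ge0_le0 // addr_ge0 ?sqr_ge0.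
case: s => // a t _ /rootP; rewrite -/(p (a :: t)) => pz0.
have: y * w (a :: t) < 0.
  rewrite wS ltr_wnDr //; last first.
    by rewrite oppr_lt0 mulr_gt0 // exprn_even_gt0.
  by rewrite mulr_ge0_le0 // addr_ge0 ?sqr_ge0.
by rewrite /w pz0 /= !mul0r subrr mulr0 ltxx.
Qed.

(** The derivative splits over the complex numbers; its roots there are real, so the factorization
    descends to [R]. *)
Lemma deriv_prod_XsubC (R : rcfType) (s : seq R) : s != [::] ->
  exists t : seq R, (size t).+1 = size s /\
    (\prod_(a <- s) ('X - a%:P))^`()
      = (size s)%:R *: \prod_(b <- t) ('X - b%:P).
Proof.
move=> s_nil; set p := \prod_(_ <- s) _.
have pC : map_poly (complex.real_complex R) p = \prod_(a <- s) ('X - (a%:C%C)%:P).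
  by rewrite rmorph_prod; apply: eq_bigr => a _; exact: map_polyXsubC.
have [r Dr] := closed_field_poly_normal (map_poly (complex.real_complex R) p^`()).
have size_p : size p = (size s).+1 by rewrite size_prod_XsubC.
have s_gt0 : (0 < size s)%N by case: (s) s_nil.
have lead_dp : p^`()`_(size s).-1 = (size s)%:R.
  rewrite coef_deriv prednK //.
  have := monic_prod_XsubC s xpredT id.
  by rewrite monicE /lead_coef size_p => /eqP /= ->.
have size_dp : size p^`() = size s by rewrite size_deriv size_p.
have lead_dpC : lead_coef (map_poly (complex.real_complex R) p^`()) = (size s)%:R.
  by rewrite lead_coef_map /lead_coef size_dp lead_dp rmorph_nat.
have size_r : (size r).+1 = size s.
  rewrite -size_dp -(size_map_poly (complex.real_complex R)) Dr.
  rewrite size_scale ?size_prod_XsubC //.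
  by rewrite lead_dpC pnatr_eq0 -lt0n.
exists (map (@complex.Re R) r); rewrite size_map; split=> //.
apply: (@map_poly_inj _ _ (complex.real_complex R)).
rewrite Dr lead_dpC map_polyZ rmorph_nat big_map; congr (_ *: _).
rewrite rmorph_prod; apply: eq_big_seq => z rz.
rewrite -[RHS]/(map_poly _ _) map_polyXsubC; congr ('X - _%:P).
suff: complex.Im z = 0 by case: z {rz} => x y /= ->.
apply: (deriv_prod_XsubC_root_real s_nil); rewrite -pC deriv_map Dr.
by rewrite rootZ ?root_prod_XsubC // lead_dpC pnatr_eq0 -lt0n.
Qed.

(** * Newton's inequality *)

(** For nonzero roots this is Cauchy-Schwarz applied to their reciprocals; induction on [s] also
    covers zero roots. *)
Lemma newton_low_coef (R : realFieldType) (s : seq R) :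
  let p := \prod_(a <- s) ('X - a%:P) in
  (2 * size s)%:R * p`_0 * p`_2 <= ((size s)%:R - 1) * p`_1 ^+ 2.
Proof.
move=> /=; elim: s => [|a s IH].
  by rewrite big_nil !coef1 /= expr0n /= !mulr0 lexx.
rewrite big_cons; set q := \prod_(_ <- s) _ in IH *.
have -> : ('X - a%:P) * q = 'X * q - a%:P * q by rewrite mulrBl.
rewrite !coefB !coefXM !coefCM /= sub0r.
case: (posnP (size s)) => [/size0nil s0|s_gt0].
  by rewrite /q s0 big_nil !coef1 /= !mulr0 !subr0 mulr0 subrr mul0r lexx.
have n_gt0 : 0 < (size s)%:R :> R by rewrite ltr0n.
move: IH; rewrite !natrM -[(size s).+1%:R]natr1 addrK.
move: (size s)%:R n_gt0 q`_0 q`_1 q`_2.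
move=> n n_gt0 q0 q1 q2 IH; rewrite -(ler_pM2l n_gt0) -subr_ge0.
(* The factor n completes the square and leaves a nonnegative multiple of the defect in [IH]. *)
rewrite (_ : _ - _ = (n * q0 + a * q1) ^+ 2
  + a ^+ 2 * (n + 1) * ((n - 1) * q1 ^+ 2 - 2 * n * q0 * q2)); last by ring.
rewrite addr_ge0 ?sqr_ge0 // mulr_ge0 ?subr_ge0 //.
by rewrite mulr_ge0 ?sqr_ge0 ?addr_ge0 ?ltW.
Qed.

Lemma newton_coef (R : rcfType) (s : seq R) (m : nat) :
  let p := \prod_(a <- s) ('X - a%:P) in
  (m < size s)%N ->
  (m.+2 * (size s - m))%:R * p`_m * p`_m.+2
    <= (m.+1 * (size s - m.+1))%:R * p`_m.+1 ^+ 2.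
Proof.
move=> /=; elim: m s => [|m IH] s lt_m.
  by have := newton_low_coef s; rewrite subn0 mul1n natrB.
have s_nil : s != [::] by case: (s) lt_m.
have [t [size_t Dt]] := deriv_prod_XsubC s_nil.
have lt_mt : (m < size t)%N by rewrite -ltnS size_t.
have := IH t lt_mt; set q := \prod_(_ <- t) _ in Dt *.
set p := \prod_(_ <- s) _ in Dt *.
have coefq i : (size s)%:R * q`_i = i.+1%:R * p`_i.+1.
  by rewrite -coefZ -Dt coef_deriv mulr_natl.
have N_gt0 : 0 < (size s)%:R :> R by rewrite ltr0n -size_t.
rewrite -(ler_pM2l (exprn_gt0 2 N_gt0)).
have -> c : (size s)%:R ^+ 2 * (c * q`_m.+1 ^+ 2) = c * (m.+2%:R * p`_m.+2) ^+ 2.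
  by rewrite -coefq; ring.
have -> c : (size s)%:R ^+ 2 * (c * q`_m * q`_m.+2)
    = c * (m.+1%:R * p`_m.+1) * (m.+3%:R * p`_m.+3).
  by rewrite -!coefq; ring.
rewrite -size_t !subSS => le_qp.
(* The inequality for the derivative is the goal multiplied by (m + 1)(m + 2). *)
have mm_gt0 : 0 < m.+1%:R * m.+2%:R :> R by rewrite -natrM ltr0n.
rewrite -(ler_pM2l mm_gt0); apply: le_trans (le_trans le_qp _);
  by rewrite le_eqVlt !natrM; apply/orP; left; apply/eqP; ring.
Qed.

Lemma sigma0 (R : realType) (n : nat) (lambda : 'rV[R]_n) : sigma 0 lambda = 1.
Proof. by rewrite /sigma mpoly.mesym0E rmorph1. Qed.

(** By Vieta, sigma_j is up to sign the coefficient of degree n - j; the signs for j - 1 and j + 1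
    agree and cancel. *)
Lemma newton_sigma (R : realType) (n j : nat) (lambda : 'rV[R]_n) :
  (0 < j <= n)%N ->
  (j.+1 * (n - j).+1)%:R * sigma j.-1 lambda * sigma j.+1 lambda
    <= (j * (n - j))%:R * sigma j lambda ^+ 2.
Proof.
case: j => // j /= lt_jn.
(* Here the index n - (j + 2) used below would truncate, but both sides vanish. *)
have [n_eq|ne_jn] := eqVneq n j.+1.
  have ->: (n - j.+1 = 0)%N by rewrite n_eq subnn.
  rewrite muln0 mul0r (_ : sigma j.+2 _ = 0) ?mulr0 ?lexx //.
  by rewrite /sigma mpoly.mesym_geqnE ?rmorph0 // n_eq.
have {ne_jn lt_jn} lt_jn : (j.+1 < n)%N by rewrite ltn_neqAle eq_sym ne_jn.
pose cs := [tuple lambda 0 i | i < n].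
have sigma_coef k : (k <= n)%N ->
    (\prod_(c <- cs) ('X - c%:P))`_(n - k) = (-1) ^+ k * sigma k lambda.
  rewrite -ltnS => lt_k; have := mpoly.mroots_coeff cs (Ordinal lt_k).
  move=> /= ->; congr (_ * _); apply: mpoly.meval_eq => i.
  by rewrite tnth_mktuple.
have := @newton_coef R cs (n - j.+2); rewrite size_tuple ltn_subrL; lazy zeta.
have -> : (n - j.+2).+2 = (n - j)%N by rewrite -!subSn // ltnW.
have -> : (n - j.+2).+1 = (n - j.+1)%N by rewrite -subSn.
rewrite !subKn // ?(ltnW lt_jn) // !sigma_coef // ?(ltnW lt_jn) //;
  last by do 2 apply: ltnW.
rewrite (leq_trans _ lt_jn) // => /(_ isT).
rewrite exprMn sqrr_sign mul1r -mulrA mulrACA.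
have -> : (-1) ^+ j.+2 * (-1) ^+ j = 1 :> R.
  by rewrite -exprD -signr_odd oddD /= negbK addbb.
rewrite mul1r subnSK 1?ltnW //.
by rewrite [(_ * (n - j))%N]mulnC [(_ * (n - j.+1))%N]mulnC mulrAC mulrA.
Qed.

(** Cross-multiplied monotonicity of sigma_j / ((n - j + 1) sigma_(j-1)); Newton's inequality gives
    each step of the induction on [k]. *)
Lemma sigma_ratio_le (R : realType) (n k l : nat) (lambda : 'rV[R]_n) :
  Gamma k lambda -> (0 < l <= k)%N -> (k <= n)%N ->
  (n - l).+1%:R * sigma l.-1 lambda * sigma k lambda
  <= (n - k).+1%:R * sigma l lambda * sigma k.-1 lambda.
Proof.
elim: k => [|k IH] lam_k1 /andP[l_gt0 le_lk1] lt_kn.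
  by case: l l_gt0 le_lk1.
have [->|ne_lk] := eqVneq l k.+1; first by rewrite mulrAC.
have le_lk : (l <= k)%N by rewrite -ltnS ltn_neqAle ne_lk.
have sg_gt0 i : (i <= k.+1)%N -> 0 < sigma i lambda.
  by case: i => [|i] le_i; [rewrite sigma0|apply: lam_k1].
have k_gt0 := leq_trans l_gt0 le_lk.
have {}IH : (n - l).+1%:R * sigma l.-1 lambda * sigma k lambda
    <= (n - k).+1%:R * sigma l lambda * sigma k.-1 lambda.
  apply: IH (ltnW lt_kn); last by rewrite l_gt0 le_lk.
  by move=> i /andP[i_gt0 le_ik]; apply: lam_k1; rewrite i_gt0 leqW.
(* The factor k on the right of Newton's inequality is enlarged to k + 1 and cancelled. *)
have newton : (n - k).+1%:R * sigma k.-1 lambda * sigma k.+1 lambda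
    <= (n - k)%:R * sigma k lambda ^+ 2.
  rewrite -(@ler_pM2l _ k.+1%:R) ?ltr0n // !mulrA -!natrM.
  apply: le_trans (newton_sigma lambda _) _; first by rewrite k_gt0 ltnW.
  rewrite -[leRHS]mulrA -expr2 ler_wpM2r ?sqr_ge0 //.
  by rewrite ler_nat leq_mul2r leqnSn orbT.
rewrite subnSK //= -(ler_pM2r (sg_gt0 k _)) //.
have := ler_wpM2l (ltW (sg_gt0 l (leqW le_lk))) newton.
have := ler_wpM2r (ltW (sg_gt0 k.+1 (leqnn _))) IH.
by lra.
Qed.

(** * Partial derivatives of the sigma_j and their quotients *)

(** The difference quotient is constant for h != 0. This applies to sigma_j, which is affine in each
    coordinate. *)
Lemma is_derive_affine (R : realType) (V : normedModType R) (f : V -> R) (x v : V)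
    (c : R) :
  (forall h : R, f (h *: v + x) = f x + h * c) -> is_derive x v f c.
Proof.
move=> fE.
have cvf : (fun h => h^-1 *: ((f \o shift x) (h *: v) - f x)) @ 0^' --> c.
  apply: cvg_near_cst; near=> h.
  rewrite /= fE addrC addKr /GRing.scale /= mulKf //.
  by near: h; exact: nbhs_dnbhs_neq.
by apply: DeriveDef; [exact: cvgP cvf | exact: cvg_lim cvf].
Unshelve. all: by end_near. Qed.

(** The function sigma_j of [lambda] with its i-th entry deleted, often written
    sigma_j(lambda|i). *)
Definition sigma_minor (R : realType) (n j : nat) (lambda : 'rV[R]_n) (i : 'I_n) : R :=
  \sum_(A : {set 'I_n} | (#|A| == j) && (i \notin A)) \prod_(k in A) lambda 0 k.

(** Double counting: each set of size j is avoided by n - j indices. *)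
Lemma sum_sigma_minor (R : realType) (n j : nat) (lambda : 'rV[R]_n) :
  \sum_(i < n) sigma_minor j lambda i = (n - j)%:R * sigma j lambda.
Proof.
rewrite /sigma_minor sigmaE mulr_sumr.
rewrite (exchange_big_dep (fun A : {set 'I_n} => #|A| == j)) /=; last first.
  by move=> i A _ /andP[].
apply: eq_bigr => A /eqP <-; rewrite sumr_const mulr_natl; congr (_ *+ _).
rewrite -[X in (X - _)%N]card_ord -(cardC A) addKn; apply: eq_card => i.
by rewrite !inE /= eqxx.
Qed.

Lemma sigmaS_split (R : realType) (n j : nat) (lambda : 'rV[R]_n) (i : 'I_n) :
  sigma j.+1 lambda = sigma_minor j.+1 lambda i + lambda 0 i * sigma_minor j lambda i.
Proof.
rewrite sigmaE (bigID (fun A : {set 'I_n} => i \notin A)) /=; congr (_ + _).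
rewrite mulr_sumr (reindex_onto (fun B => i |: B) (fun A => A :\ i)) /=; last first.
  by move=> A /andP[_ /negPn iA]; rewrite finset.setD1K.
apply: eq_big => [B|B].
  rewrite finset.setU11 /= andbT cardsU1; have [iB|iB] /= := boolP (i \in B).
    rewrite andbF; apply/andP => -[_ /eqP DB].
    by move: iB; rewrite -DB !inE eqxx.
  by rewrite add1n eqSS finset.setU1K // eqxx !andbT.
move=> /andP[_ /eqP DB].
have iB : i \notin B by rewrite -DB !inE eqxx.
by rewrite finset.big_setU1.
Qed.

Lemma sigma_minor_shift (R : realType) (n j : nat) (lambda : 'rV[R]_n) (i : 'I_n)
    (h : R) :
  sigma_minor j (h *: delta_mx 0 i + lambda) i = sigma_minor j lambda i.
Proof.
apply: eq_bigr => A /andP[_ iA]; apply: eq_bigr => k kA.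
rewrite !mxE eqxx /= (_ : (k == i) = false) ?mulr0 ?add0r //.
by apply: contraNF iA => /eqP <-.
Qed.

Definition sigma_partial (R : realType) (n j : nat) (lambda : 'rV[R]_n) (i : 'I_n) : R :=
  if j is j'.+1 then sigma_minor j' lambda i else 0.

Lemma is_derive_sigma (R : realType) (n j : nat) (lambda : 'rV[R]_n) (i : 'I_n) :
  is_derive lambda (delta_mx 0 i) (@sigma R n j) (sigma_partial j lambda i).
Proof.
apply: is_derive_affine => h; case: j => [|j] /=; first by rewrite !sigma0 mulr0 addr0.
rewrite !(sigmaS_split _ _ i) !sigma_minor_shift !mxE !eqxx mulr1.
by ring.
Qed.

Lemma is_derive_quot (R : realType) (V : normedModType R) (f g : V -> R) (x v : V)
    (df dg : R) :
  g x != 0 -> is_derive x v f df -> is_derive x v g dg ->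
  is_derive x v (fun y => f y / g y) ((df * g x - f x * dg) / g x ^+ 2).
Proof.
move=> gx0 fD gD.
have gVD : is_derive x v (fun y => (g y)^-1) (- g x ^- 2 * dg).
  by split; [apply: derivableV => //; case: gD
            |rewrite deriveV //; case: gD => _ ->].
apply: (is_derive_eq (is_deriveM fD gVD)).
by rewrite /GRing.scale /=; field.
Qed.

(** The quotient rule is linear in the numerator's derivatives and in those of the denominator, so
    summing over i replaces them by the sums [S]. *)
Lemma sum_partial_sigma_quot (R : realType) (n k : nat) (beta : 'I_k.-1 -> R)
    (lambda : 'rV[R]_n) (S := fun j => \sum_(i < n) sigma_partial j lambda i)
    (Q := fun j => (S j * sigma k.-1 lambda - sigma j lambda * S k.-1)
                   / sigma k.-1 lambda ^+ 2) :
  sigma k.-1 lambda != 0 ->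
  \sum_(i < n) partial (sigma_quot beta) i lambda
    = Q k - \sum_(l < k.-1) beta l * Q l.
Proof.
move=> s0.
pose q j i := (sigma_partial j lambda i * sigma k.-1 lambda
  - sigma j lambda * sigma_partial k.-1 lambda i) / sigma k.-1 lambda ^+ 2.
have sum_q j : \sum_(i < n) q j i = Q j.
  by rewrite -mulr_suml sumrB -mulr_suml -mulr_sumr.
have partialE i : partial (sigma_quot beta) i lambda
    = q k i - \sum_(l < k.-1) beta l * q l i.
  have qD j := is_derive_quot s0
    (is_derive_sigma j lambda i) (is_derive_sigma k.-1 lambda i).
  have := is_deriveB (qD k)
    (is_derive_sum (fun l : 'I_k.-1 => is_deriveZ (beta l) (qD l))).
  rewrite /partial => -[_ <-]; congr ('D_ _ _ _); apply/funext => y.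
  by rewrite /sigma_quot /= fct_sumE.
rewrite (eq_bigr _ (fun i _ => partialE i)) sumrB sum_q exchange_big; congr (_ - _).
by apply: eq_bigr => l _; rewrite -mulr_sumr sum_q.
Qed.

Theorem lemma2p9 (R : realType) (n k : nat) (hk : (2 <= k <= n)%N)
    (beta : 'I_k.-1 -> R) (hbeta : forall l, 0 <= beta l)
    (lambda : 'rV[R]_n) (hlambda : Gamma k.-1 lambda) :
  (n%:R - k%:R + 1) / k%:R <= \sum_(i < n) partial (sigma_quot beta) i lambda.
Proof.
(* From here on the k of the statement is [k.+2], and the denominator is sigma_(k+1). *)
case: k hk beta hbeta hlambda => [|[|k]] //= lt_kn beta beta_ge0 lam.
have sg_gt0 i : (i <= k.+1)%N -> 0 < sigma i lambda.
  by case: i => [|i] le_i; [rewrite sigma0|apply: lam].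
have sq_gt0 := exprn_gt0 2 (sg_gt0 k.+1 (leqnn _)).
rewrite sum_partial_sigma_quot ?gt_eqF ?sg_gt0 //= !sum_sigma_minor.
rewrite -[leLHS]addr0 -[in leLHS]oppr0; apply: lerD; last first.
  rewrite lerN2; apply: sumr_le0 => l _; rewrite mulr_ge0_le0 //.
  rewrite pmulr_lle0 ?invr_gt0 // subr_le0.
  (* For l = 0 the derivative of sigma_l vanishes; otherwise monotonicity of the ratios gives the
     sign. *)
  case: l => -[|l] /= lt_l.
    by rewrite big1_eq mul0r !mulr_ge0 ?ler0n ?ltW ?sg_gt0.
  rewrite sum_sigma_minor.
  have := sigma_ratio_le lam (l := l.+1) _ (ltnW lt_kn).
  rewrite subnSK; last exact: ltn_trans (ltnW lt_l) lt_kn.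
  rewrite subnSK ?(ltnW lt_kn) //= => /(_ (leqW lt_l)).
  by rewrite mulrA [sigma l.+1 _ * _]mulrC.
(* Newton's inequality leaves the fraction 1 - (k + 1)/(k + 2) = 1/(k + 2) of n - k - 1, which is
   the required bound. *)
have := @newton_sigma R n k.+1 lambda (ltnW lt_kn).
have -> : n%:R - k.+2%:R + 1 = (n - k.+1)%:R :> R.
  by rewrite natrB ?(ltnW lt_kn) // -[k.+2%:R]natr1; ring.
rewrite subnSK ?(ltnW lt_kn) // ler_pdivlMr // => newton.
rewrite [leLHS]mulrAC ler_pdivrMr ?ltr0n //; move: newton.
rewrite !natrM -[k.+2%:R]natr1 /=.
by lra.
Qed.
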